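(* (a) Let $R$ be an associative unitary ring and let $k\ge 3$ be an integer. The group $\mathrm{EL}_k(R)$ has a faithful finite dimensional linear representation over $\mathbb{C}$ if and only if $R$ has a two-sided ideal $I$ of finite index such that $I$ admits a faithful finite dimensional representation over $\mathbb{C}$. (b) The group $\mathrm{EL}_3(\mathbb{Z}\langle x,y\rangle)$ does not have a faithful finite dimensional linear representation over any field.
   Context: For an associative unitary ring $R$, $\mathrm{EL}_k(R)$ is the subgroup of $\mathrm{GL}_k(R)$ generated by all elementary matrices $x_{ij}(r)=\mathrm{Id}+r e_{ij}$ with $r\in R$, $1\le i\neq j\le k$. $\mathbb{Z}\langle x,y\rangle$ is the free (non-commutative) associative unitary ring on two generators. A faithful finite dimensional linear representation of a group $G$ over a field $K$ is an injective group homomorphism $G\to\mathrm{GL}_n(K)$ for some $n$. An ideal $I$ has finite index if the quotient ring $R/I$ is finite. A faithful finite dimensional representation of $I$ (a ring not necessarily containing a unit) over $\mathbb{C}$ is an injective map $I\to\mathrm{Mat}_n(\mathbb{C})$, for some $n$, preserving addition and multiplication. *)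

(* Defs.v *)
From HB Require Import structures.
From mathcomp Require Import all_boot all_order all_algebra.
From mathcomp Require Import classical_sets cardinality.
From mathcomp Require Import monalg.

Set Implicit Arguments.
Unset Strict Implicit.
Unset Printing Implicit Defensive.

Import GRing.Theory.
Local Open Scope classical_set_scope.
Local Open Scope ring_scope.

Section GeneralLinear.
Variables (R : pzRingType) (k : nat).

(* [unitmx] needs a commutative ring, hence two-sided inverses. *)
Definition GL : set 'M[R]_k :=
  [set A | exists B, A *m B = 1%:M /\ B *m A = 1%:M].

Definition GL_subgroup (H : set 'M[R]_k) : Prop :=
  [/\ H `<=` GL,
      H 1%:M,
      forall A B, H A -> H B -> H (A *m B)
    & forall A B, H A -> A *m B = 1%:M -> B *m A = 1%:M -> H B].

Definition elem_mx (i j : 'I_k) (r : R) : 'M[R]_k := 1%:M + r *: delta_mx i j.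

Definition EL : set 'M[R]_k :=
  smallest GL_subgroup [set A | exists i j r, i != j /\ A = elem_mx i j r].

End GeneralLinear.

Arguments EL : clear implicits.

(* A homomorphism on the subgroup G is encoded by a total map on matrices, of
   which only the restriction to G matters. *)
Definition faithful_group_rep (R : pzRingType) (k : nat) (G : set 'M[R]_k)
    (K : fieldType) : Prop :=
  exists (n : nat) (rho : 'M[R]_k -> 'M[K]_n),
    [/\ {homo rho : A / G A >-> GL A},
        {in G &, {morph rho : A B / A *m B}}
      & {in G &, injective rho}].

Definition two_sided_ideal (R : pzRingType) (I : set R) : Prop :=
  [/\ I 0,
      forall a b, I a -> I b -> I (a - b)
    & forall r a, I a -> I (r * a) /\ I (a * r)].

(* The quotient R / I as the set of cosets of I. *)
Definition cosets (R : pzRingType) (I : set R) : set (set R) :=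
  range (fun a : R => [set b | I (b - a)]).

Definition finite_index (R : pzRingType) (I : set R) : Prop :=
  finite_set (cosets I).

(* As for groups, only the restriction of phi to I matters; nothing is required
   about a unit. *)
Definition faithful_ideal_rep (R : pzRingType) (I : set R) (K : fieldType) :
    Prop :=
  exists (n : nat) (phi : R -> 'M[K]_n),
    [/\ {in I &, {morph phi : a b / a + b}},
        {in I &, {morph phi : a b / a * b >-> a *m b}}
      & {in I &, injective phi}].

(* Z<x, y>: the monoid ring over Z of the free monoid on two letters. *)
Definition free_ring2 : pzRingType :=
  {malg int[{fmonom bool}]}.

(* Main.v *)
From HB Require Import structures.
Require Import Defs.
From mathcomp Require Import all_boot all_order all_algebra.
From mathcomp Require Import classical_sets reals.
From mathcomp Require Import complex.
From mathcomp Require Import fingroup perm finmap monalg boolp cardinality.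
From mathcomp Require Import mxred spectral.

(**
Let [rho] be a faithful representation of [EL_k(R)] in dimension [n] over a
field [K], and write [X_ij(r)] for the image of [x_ij(r)].  Since [X_13(r)] is
the central commutator of [X_12(r)] and [X_23(1)], the matrix [X_13(r)^(n!)] is
unipotent.  In characteristic [p] a unipotent matrix has finite order, so [R]
has nonzero characteristic.  In characteristic [0], the [r] such that [X_13(r)]
is unipotent form an ideal [U] of [R] containing [n! R], the logarithm [L(r)]
of [X_13(r)] is additive and injective on [U], and conjugating by [X_32(1)] and
[X_23(s)] gives a linear map sending [L(r)] to [L(rs)].  So [R] acts on the
span of [L(U)], with a kernel annihilated by [n!].  Over an algebraically
closed field [U] has finite index, because simultaneous triangularization of
the [X_13(r)] leaves finitely many diagonals of roots of unity.  Conversely, a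
representation of an ideal of finite index containing [N R] extends to [R] upon
dividing by [N], and together with the permutation action of matrices on the
finite set [(R/I)^k] it gives a faithful representation of [EL_k(R)].

A faithful representation of [EL_3(Z<x,y>)] would then embed [Z<x,y>] in a
matrix ring over a field, which satisfies a standard identity, whereas the
standard polynomials do not vanish on the free monomials [x^i y].
*)

Set Implicit Arguments.
Unset Strict Implicit.
Unset Printing Implicit Defensive.

Import GRing.Theory.
Local Open Scope ring_scope.

(** * Heisenberg relations and unipotency *)

Lemma dvdp_expn_sub1 (K : fieldType) (m N : nat) :
  (m %| N)%N -> ('X^m - 1 : {poly K}) %| 'X^N - 1.
Proof.
by case/dvdnP=> q ->; rewrite mulnC exprM [X in _ %| X]subrX1; exact: dvdp_mulr.
Qed.

(** Each factor is [X^m (X^(N-m) - 1)] with [N - m] dividing [N!]. The product is the value at [X^N]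
    of the polynomial with roots [X^m], [m < N], which is the pivot of the elimination in
    [heisenberg_unipotent]. *)
Lemma prodXn_sub_dvdp (K : fieldType) (N : nat) :
  (\prod_(m < N) ('X^N - 'X^m) : {poly K}) %| 'X^(N * N) * ('X^(N`!) - 1) ^+ N.
Proof.
have -> : 'X^(N * N) * ('X^(N`!) - 1) ^+ N =
    \prod_(m < N) ('X^N * ('X^(N`!) - 1)) :> {poly K}.
  by rewrite prodr_const card_ord exprMn exprM.
apply: (big_ind2 (fun p q => p %| q)) => [|p1 p2 q1 q2|m _]; first exact: dvdpp.
  exact: dvdp_mul.
have -> : 'X^N - 'X^m = 'X^m * ('X^(N - m) - 1) :> {poly K}.
  by rewrite mulrBr mulr1 -exprD subnKC // ltnW.
apply: dvdp_mul; first by rewrite dvdp_exp2l // ltnW.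
by apply/dvdp_expn_sub1/dvdn_fact; rewrite subn_gt0 ltn_ord leq_subr.
Qed.

Section Heisenberg.
Variables (K : fieldType) (n : nat) (A B Z : 'M[K]_n.+1).
Hypotheses (uA : A \is a GRing.unit) (uB : B \is a GRing.unit).
Hypotheses (cZA : GRing.comm Z A) (cZB : GRing.comm Z B).
Hypothesis AB : A * B = Z * B * A.

Lemma heisenberg_exp (i j : nat) :
  A ^+ i * B ^+ j = Z ^+ (i * j) * B ^+ j * A ^+ i.
Proof.
have ABj : A * B ^+ j = Z ^+ j * B ^+ j * A.
  elim: j => [|j IHj]; first by rewrite !expr0 !mul1r mulr1.
  rewrite exprSr mulrA IHj -mulrA AB !mulrA -(mulrA (Z ^+ j)).
  by rewrite -(commrX j cZB) !mulrA -exprSr -!mulrA.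
elim: i => [|i IHi]; first by rewrite mul0n !expr0 !mul1r mulr1.
rewrite exprS -mulrA IHi !mulrA (commrX (i * j) (commr_sym cZA)).
by rewrite -(mulrA _ A) ABj !mulrA -exprD mulSn addnC -!mulrA -exprS.
Qed.

(* Conjugating the Cayley-Hamilton identity [sum_j c_j B^j = 0] by [A^i] gives
   [sum_j c_j Z^(i j) B^j = 0] for every [i]; a Vandermonde elimination in
   [K[Z]] then isolates the leading term [B^(n+1)]. *)
Lemma heisenberg_unipotent : (Z ^+ (n.+1)`! - 1) ^+ n.+1 = 0.
Proof.
set N := n.+1; pose p := char_poly B.
have szp : size p = N.+1 by rewrite size_char_poly.
pose u (j : nat) := p`_j *: B ^+ j.
have uN : u N = B ^+ N.
  have /monicP := char_poly_monic B; rewrite /lead_coef szp /= /u => ->.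
  by rewrite scale1r.
have u0 i : \sum_(j < N.+1) Z ^+ (i * j) * u j = 0.
  have := Cayley_Hamilton B; rewrite -/p -[p]coefK poly_def rmorph_sum /= szp.
  move=> CH; have: A ^+ i * 0 * (A ^+ i)^-1 = 0 by rewrite mulr0 mul0r.
  rewrite -[X in _ * X * _]CH mulr_sumr mulr_suml => {2}<-.
  apply: eq_bigr => j _; rewrite linearZ /= rmorphXn /= horner_mx_X.
  rewrite /u -!scalerAr -scalerAl; congr (_ *: _).
  by rewrite heisenberg_exp mulrK // unitrX.
(* Combining the relations [u0] with the coefficients of [q], taken at [Z], turns the factor of
   [u j] into the value of [q] at the node [X^j]. *)
have uq (q : {poly {poly K}}) :
    \sum_(j < N.+1) horner_mx Z q.['X^j] * u j = 0.
  under eq_bigr => j _ do rewrite horner_coef rmorph_sum mulr_suml.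
  rewrite exchange_big /= big1 // => i _.
  transitivity (horner_mx Z q`_i * \sum_(j < N.+1) Z ^+ (i * j) * u j).
    rewrite mulr_sumr.
    apply: eq_bigr => j _.
    by rewrite rmorphM !rmorphXn /= horner_mx_X -exprM mulnC mulrA.
  by rewrite u0 mulr0.
have := uq (\prod_(m < N) ('X - ('X^m)%:P)).
rewrite big_ord_recr big1 /= => [|j _]; last first.
  rewrite horner_prod (bigD1 j) //= hornerXsubC subrr mul0r.
  by rewrite rmorph0 mul0r.
rewrite add0r uN horner_prod; under eq_bigr do rewrite hornerXsubC.
move=> /(congr1 ( *%R^~ (B ^+ N)^-1)); rewrite mul0r mulrK ?unitrX // => h0.
have /dvdpP[q] := prodXn_sub_dvdp K N.
move=> /(congr1 (horner_mx Z)); rewrite [in RHS]rmorphM /=. rewrite h0 mulr0.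
rewrite rmorphM !rmorphXn rmorphB rmorph1 rmorphXn /= horner_mx_X => Z0.
(* [Z] is a commutator of units, so the power [Z^(N N)] can be cancelled. *)
have uZ : Z ^+ (N * N) \is a GRing.unit.
  have : Z = A * B * A^-1 * B^-1 by rewrite AB mulrK // mulrK.
  by move=> ->; rewrite unitrX // !unitrMl ?unitrV.
by apply: (mulrI uZ); rewrite mulr0.
Qed.

End Heisenberg.

(** * Unipotent matrices and their logarithms *)

Lemma expr_leq_eq0 (R : pzSemiRingType) (x : R) i j :
  (i <= j)%N -> x ^+ i = 0 -> x ^+ j = 0.
Proof. by move=> le_ij xi; rewrite -(subnK le_ij) exprD xi mulr0. Qed.

Lemma exprJ (R : unitRingType) (g x : R) k : g \is a GRing.unit ->
  (g^-1 * x * g) ^+ k = g^-1 * x ^+ k * g.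
Proof.
move=> ug; elim: k => [|k IHk]; first by rewrite !expr0 mulr1 mulVr.
by rewrite !exprS IHk !mulrA mulrK.
Qed.

Section Unipotent.
Variables (K : fieldType) (n : nat).
Implicit Types X Y g : 'M[K]_n.+1.

Definition unipotent X := (X - 1) ^+ n.+1 == 0.

(** The minimal polynomial divides a power of ['X - 1], so up to a scalar it is such a power; its
    degree is at most [n + 1] because it divides the characteristic polynomial. *)
Lemma unipotentP X : reflect (exists q, (X - 1) ^+ q = 0) (unipotent X).
Proof.
apply: (iffP eqP) => [|[q Xq]]; first by exists n.+1.
have hX k : horner_mx X (('X - 1%:P) ^+ k) = (X - 1) ^+ k.
  by rewrite rmorphXn rmorphB /= horner_mx_X horner_mx_C.
have: mxminpoly X %| ('X - 1%:P) ^+ q by apply: mxminpoly_min; rewrite hX.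
case/dvdp_exp_XsubCP=> k _ eqk.
have le_k : (k <= n.+1)%N.
  have := dvdp_leq (monic_neq0 (char_poly_monic X)) (mxminpoly_dvd_char X).
  by rewrite (eqp_size eqk) size_exp_XsubC size_char_poly.
apply: (expr_leq_eq0 le_k); rewrite -hX; apply/mxminpoly_minP.
by have /andP[] := eqk.
Qed.

Lemma unipotent1 : unipotent 1.
Proof. by rewrite /unipotent subrr expr0n. Qed.

Lemma unipotentM X Y :
  GRing.comm X Y -> unipotent X -> unipotent Y -> unipotent (X * Y).
Proof.
move=> cXY /eqP uX /eqP uY; apply/unipotentP; exists (n.+1 + n.+1)%N.
have cXY1 : GRing.comm (X - 1) (Y - 1).
  apply: commrB; last exact: commr1.
  by apply/commr_sym/commrB; [exact: commr_sym|exact: commr1].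
have cX1Y : GRing.comm (X - 1) Y.
  by apply/commr_sym/commrB; [exact: commr_sym|exact: commr1].
(* A sum of two commuting nilpotents: in each binomial term of its power [2(n + 1)], one of the two
   exponents is at least [n + 1]. *)
have -> : X * Y - 1 = (X - 1) * Y + (Y - 1).
  by rewrite mulrBl mul1r addrA subrK.
have c : GRing.comm ((X - 1) * Y) (Y - 1).
  by apply/commr_sym/commrM => //; exact/commr_sym/commrB/commr1.
rewrite exprDn_comm // big1 // => i _.
rewrite exprMn_comm //.
have [le_i|lt_i] := leqP n.+1 i.
  by rewrite (expr_leq_eq0 le_i uY) !mulr0 mul0rn.
have le_n : (n.+1 <= n.+1 + n.+1 - i)%N.
  by rewrite -addnBA ?leq_addr // ltnW.
by rewrite (expr_leq_eq0 le_n uX) !mul0r mul0rn.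
Qed.

Lemma unipotent_unit X : unipotent X -> X \is a GRing.unit.
Proof.
move=> /eqP uX; set S := \sum_(i < n.+1) (1 - X) ^+ i.
have XS : X * S = 1.
  have := subrX1 (1 - X) n.+1.
  rewrite -{1}[1 - X]opprB exprNn uX mulr0 sub0r addrAC subrr sub0r mulNr.
  by move/oppr_inj.
apply/unitrP; exists S; split => //; rewrite -[RHS]XS.
apply/commr_sym/commr_sum => i _; apply/commrX/commrB => //; exact: commr1.
Qed.

Lemma expr_subr1J g X k : g \is a GRing.unit ->
  (g^-1 * X * g - 1) ^+ k = g^-1 * (X - 1) ^+ k * g.
Proof. by move=> ug; rewrite -exprJ // mulrBr mulrBl mulr1 mulVr. Qed.

Lemma unipotentJ g X :
  g \is a GRing.unit -> unipotent X -> unipotent (g^-1 * X * g).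
Proof.
by move=> ug /eqP uX; rewrite /unipotent expr_subr1J // uX mulr0 mul0r.
Qed.

Lemma unipotentV X : unipotent X -> unipotent X^-1.
Proof.
move=> uX; have XU := unipotent_unit uX; apply/unipotentP; exists n.+1.
have -> : X^-1 - 1 = - X^-1 * (X - 1).
  by rewrite mulrBr mulr1 mulNr mulVr // opprK addrC.
rewrite exprMn_comm ?(eqP uX) ?mulr0 //.
apply: commrB; last exact: commr1.
by apply/commr_sym/commrN/commrV.
Qed.

End Unipotent.

Section Logarithm.
Variable K : fieldType.
Hypothesis K0 : [pchar K] =i pred0.

Let natK_neq0 m : (0 < m)%N -> m%:R != 0 :> K.
Proof. by have /pcharf0P-> := K0; rewrite lt0n. Qed.

(** The binomial coefficient [t] choose [i] as a polynomial in [t]. *)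
Definition bin_poly (i : nat) : {poly K} :=
  (i`!%:R)^-1 *: \prod_(l < i) ('X - l%:R%:P).

Lemma horner_bin_poly (i j : nat) : (bin_poly i).[j%:R] = 'C(j, i)%:R.
Proof.
rewrite hornerZ horner_prod.
under eq_bigr do rewrite hornerXsubC.
have -> : \prod_(l < i) (j%:R - l%:R) = (j ^_ i)%:R :> K.
  elim: i => [|i IHi]; first by rewrite big_ord0.
  rewrite big_ord_recr /= IHi ffactnSr natrM.
  have [le_ij|lt_ji] := leqP i j; first by rewrite natrB.
  by rewrite ffact_small // !mul0r.
by rewrite -bin_ffact natrM mulrC mulfK // natK_neq0 // fact_gt0.
Qed.

(** In characteristic zero the naturals are distinct in [K], so [size (p - q)] of them are already
    too many roots. *)
Lemma eq_poly_nat (p q : {poly K}) :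
  (forall j : nat, p.[j%:R] = q.[j%:R]) -> p = q.
Proof.
move=> eq_pq; apply/eqP; rewrite -subr_eq0; apply/eqP.
pose rs : seq K := [seq j%:R | j <- iota 0 (size (p - q))].
apply: (@roots_geq_poly_eq0 _ _ rs); last by rewrite size_map size_iota.
  apply/allP=> _ /mapP[j _ ->].
  by rewrite rootE hornerD hornerN eq_pq subrr.
rewrite map_inj_uniq ?iota_uniq // => i j.
wlog le_ij : i j / (i <= j)%N => [IH|/eqP].
  by case: (leqP i j) => [/IH//|/ltnW/IH h /esym/h].
rewrite eq_sym -subr_eq0 -natrB //; have [|] := posnP (j - i).
  by move/eqP; rewrite subn_eq0 => le_ji _; apply/eqP; rewrite eqn_leq le_ij.
by move/natK_neq0/negbTE ->.
Qed.

Variable n : nat.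
Implicit Types X Y g : 'M[K]_n.+1.

Let eval (j : nat) : 'M[{poly K}]_n.+1 -> 'M[K]_n.+1 :=
  map_mx (horner_eval j%:R).

Let eval_inj P Q : (forall j, eval j P = eval j Q) -> P = Q.
Proof.
move=> eqPQ; apply/matrixP => a b; apply: eq_poly_nat => j.
by have /matrixP/(_ a b) := eqPQ j; rewrite !mxE.
Qed.

(* The matrix of polynomials in [t] interpolating the powers [X^t]. *)
Definition pow_poly X : 'M[{poly K}]_n.+1 :=
  \sum_(i < n.+1) bin_poly i *: map_mx polyC ((X - 1) ^+ i).

(** For unipotent [X], the coefficient of [t] in [X^t = exp(t log X)]; additivity thus reduces to an
    identity between powers, with no power series to compose. *)
Definition log_mx X : 'M[K]_n.+1 := map_mx (coefp 1) (pow_poly X).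

Lemma log_mxE X : log_mx X = \sum_(i < n.+1) (bin_poly i)`_1 *: (X - 1) ^+ i.
Proof.
apply/matrixP => a b; rewrite !mxE !summxE raddf_sum /=.
by apply: eq_bigr => i _; rewrite !mxE /= /coefp coefMC.
Qed.

Let eval_pow_poly X j : unipotent X -> eval j (pow_poly X) = X ^+ j.
Proof.
move=> /eqP uX.
have -> : eval j (pow_poly X) = \sum_(i < n.+1) (X - 1) ^+ i *+ 'C(j, i).
  apply/matrixP => a b; rewrite !mxE !summxE /horner_eval horner_sum.
  apply: eq_bigr => i _.
  by rewrite !mxE /= hornerM hornerC horner_bin_poly mulr_natl mulmxnE.
have -> : X ^+ j = ((X - 1) + 1) ^+ j by rewrite subrK.
rewrite exprD1n; pose F i := (X - 1) ^+ i *+ 'C(j, i).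
(* The sum in [pow_poly] stops by unipotency, the binomial expansion because [i <= j]; both extend
   by zeros to a common length. *)
have widen m q : (m <= q)%N -> (forall i, (m <= i)%N -> F i = 0) ->
    \sum_(i < m) F i = \sum_(i < q) F i.
  move=> le_mq F0; rewrite (big_ord_widen _ F le_mq) big_mkcond.
  by apply: eq_bigr => i _; case: ltnP => // /F0.
rewrite (widen _ (n.+1 + j.+1)%N) ?leq_addr // => [|i le_i]; last first.
  by rewrite /F (expr_leq_eq0 le_i uX) mul0rn.
rewrite [RHS](widen _ (n.+1 + j.+1)%N) ?leq_addl // => i le_i.
by rewrite /F bin_small.
Qed.

Let pow_poly_coef0 X : unipotent X -> map_mx (coefp 0) (pow_poly X) = 1.
Proof.
move=> uX; rewrite -[RHS](expr0 X) -(eval_pow_poly 0 uX).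
by apply/matrixP => a b; rewrite !mxE /= /horner_eval horner_coef0.
Qed.

(** [(X Y)^t] and [X^t Y^t] agree at every natural [t], hence as matrices of polynomials; comparing
    coefficients of [t] gives the sum, since the constant terms are 1. *)
Lemma log_mxM X Y : GRing.comm X Y -> unipotent X -> unipotent Y ->
  log_mx (X * Y) = log_mx X + log_mx Y.
Proof.
move=> cXY uX uY; rewrite /log_mx.
have -> : pow_poly (X * Y) = pow_poly X * pow_poly Y.
  apply: eval_inj => j; rewrite eval_pow_poly ?unipotentM // exprMn_comm //.
  by rewrite [in RHS]/eval map_mxM -!/(eval _ _) !eval_pow_poly.
have coef1M (P Q : 'M[{poly K}]_n.+1) : map_mx (coefp 1) (P * Q) =
    map_mx (coefp 0) P * map_mx (coefp 1) Q
    + map_mx (coefp 1) P * map_mx (coefp 0) Q.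
  apply/matrixP => a b; rewrite !mxE raddf_sum -big_split /=.
  by apply: eq_bigr => c _; rewrite !mxE /= coefM big_ord_recr big_ord1.
by rewrite coef1M !pow_poly_coef0 // mul1r mulr1 addrC.
Qed.

Lemma log_mxJ g X : g \is a GRing.unit ->
  log_mx (g^-1 * X * g) = g^-1 * log_mx X * g.
Proof.
move=> ug; rewrite !log_mxE mulr_sumr mulr_suml; apply: eq_bigr => i _.
by rewrite expr_subr1J // -scalerAr -scalerAl.
Qed.

Lemma log_mx_eq0 X : unipotent X -> log_mx X = 0 -> X = 1.
Proof.
move=> /eqP uX logX0; apply/eqP; rewrite -subr_eq0; apply/eqP.
set m := X - 1 in uX *.
have b0 : (bin_poly 0)`_1 = 0.
  by rewrite /bin_poly big_ord0 coefZ coefC mulr0.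
have b1 : (bin_poly 1)`_1 = 1.
  rewrite /bin_poly big_ord_recr big_ord0 /= mul1r subr0 invr1 scale1r.
  by rewrite coefX.
(* The logarithm is [m] plus higher powers of [m], so if [m^(j+2) = 0], multiplying it by [m^j]
   leaves only [m^(j+1)]. *)
have step j : m ^+ j.+2 = 0 -> m ^+ j.+1 = 0.
  move=> mj.
  have: m ^+ j * log_mx X = 0 by rewrite logX0 mulr0.
  rewrite log_mxE -/m mulr_sumr big_ord_recl /= b0 scale0r mulr0 add0r.
  case: n m uX mj {logX0} => [|n'] m uX mj.
    by move=> _; apply: (expr_leq_eq0 _ uX).
  rewrite big_ord_recl /= b1 scale1r -exprD addn1 big1 ?addr0 // => i _.
  rewrite -scalerAr -exprD (expr_leq_eq0 _ mj) ?scaler0 //.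
  by rewrite /= /bump !leq0n !add1n !addnS !ltnS leq_addr.
suff down j : m ^+ j.+1 = 0 -> m = 0 by exact: down uX.
by elim: j => [|j IHj] // /step.
Qed.

End Logarithm.

(** * Ring representations from operators on a span *)

Section LinearAction.
Variables (R : pzRingType) (K : fieldType) (q : nat).
Variables (U : R -> Prop) (L : R -> 'rV[K]_q) (M : R -> 'M[K]_q).
Hypothesis UM : forall r s, U r -> U (r * s).
Hypothesis LD : forall r s, U r -> U s -> L (r + s) = L r + L s.
Hypothesis LM : forall r s, U r -> L r *m M s = L (r * s).

Let rows_in m (B : 'M[K]_(m, q)) :=
  forall i, exists2 u, U u & row i B = L u.

(** A family of vectors [L u] of maximal rank spans, since appending another [L u] cannot raise the
    rank. *)
Lemma exists_spanning_rows :
  exists m (B : 'M[K]_(m, q)), rows_in B /\ forall u, U u -> (L u <= B)%MS.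
Proof.
pose P d := `[< exists m (B : 'M[K]_(m, q)), rows_in B /\ \rank B = d >].
have P0 : exists d, P d.
  exists 0%N; apply/asboolP; exists 0%N, 0; split=> [[]//|].
  by rewrite mxrank0.
have Pq d : P d -> (d <= q)%N.
  by move=> /asboolP[m [B [_ <-]]]; exact: rank_leq_col.
case: (ex_maxnP P0 Pq) => d /asboolP[m [B [UB rkB]]] maxd.
exists m, B; split=> // u Uu.
have sB : (B <= col_mx B (L u))%MS by rewrite -addsmxE addsmxSl.
suff eqB : (B == col_mx B (L u))%MS.
  by rewrite (eqmxP eqB) -addsmxE addsmxSr.
rewrite sB /= -(mxrank_leqif_sup sB) eqn_leq mxrankS //= rkB.
apply: maxd; apply/asboolP; exists (m + 1)%N, (col_mx B (L u)); split=> // i.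
case: (split_ordP i) => j ->; first by rewrite rowKu; exact: UB.
by exists u => //; rewrite rowKd row_id.
Qed.

(** [M] itself need be neither additive nor multiplicative, but on the span of [L(U)] the operator
    [M s] is determined by sending [L r] to [L (r s)]. [phi s] is its matrix in a basis of that
    span; acting on row vectors keeps the order of products. *)
Lemma linear_action : exists m (phi : {rmorphism R -> 'M[K]_m}),
  forall s, phi s = 0 -> forall r, U r -> L (r * s) = 0.
Proof.
have [m [B [UB spanB]]] := exists_spanning_rows.
pose W := row_base B; have /submxP[C defW] : (W <= B)%MS by rewrite eq_row_base.
have LW u : U u -> (L u <= W)%MS by rewrite eq_row_base; exact: spanB.
have BM s : (B *m M s <= W)%MS.
  apply/row_subP => i; rewrite row_mul; have [u Uu ->] := UB i.
  by rewrite LM // LW //; exact: UM.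
have BMM s t : B *m M s *m M t = B *m M (s * t).
  apply/row_matrixP => i; rewrite !row_mul; have [u Uu ->] := UB i.
  by rewrite !LM ?mulrA //; exact: UM.
have BMD s t : B *m M (s + t) = B *m M s + B *m M t.
  apply/row_matrixP => i; rewrite raddfD /= !row_mul; have [u Uu ->] := UB i.
  by rewrite !LM // mulrDr LD //; exact: UM.
have BM1 : B *m M 1 = B.
  apply/row_matrixP => i; rewrite row_mul; have [u Uu ->] := UB i.
  by rewrite LM // mulr1.
pose f s := W *m M s *m pinvmx W.
have fW s : f s *m W = W *m M s.
  by rewrite mulmxKpV // {1}defW -mulmxA (submx_trans (submxMl _ _)).
have injW p (A A' : 'M_(p, _)) : A *m W = A' *m W -> A = A'.
  exact/row_free_inj/row_base_free.
have WM s : W *m M s = C *m (B *m M s) by rewrite defW mulmxA.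
have f0 : f 0 = 0.
  apply: injW; rewrite fW mul0mx WM.
  have /eqP := BMD 0 0; rewrite addr0 -subr_eq0 opprD addNKr oppr_eq0.
  by move/eqP ->; rewrite mulmx0.
have fD : {morph f : s t / s + t}.
  by move=> s t; apply: injW; rewrite mulmxDl !fW !WM BMD mulmxDr.
have f1 : f 1 = 1 by apply: injW; rewrite fW mul1mx WM BM1 -defW.
have fM : {morph f : s t / s * t}.
  move=> s t; apply: injW.
  by rewrite -mulmxE -mulmxA !fW mulmxA fW !WM -BMM !mulmxA.
pose f_nmod := GRing.isNmodMorphism.Build _ _ f (f0, fD).
pose f_mon := GRing.isMonoidMorphism.Build _ _ f (f1, fM).
pose phi : {rmorphism R -> 'M[K]__} := HB.pack f f_nmod f_mon.
exists _, phi => s /= fs0 r Ur; rewrite -LM //.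
have /submxP[c ->] := LW r Ur.
by rewrite -mulmxA -fW [f s]fs0 mul0mx mulmx0.
Qed.

End LinearAction.

(** * Elementary matrices *)

Section ElementaryRelations.
Variables (R : pzRingType) (k : nat).
Implicit Types (i j l : 'I_k) (r s : R).

Lemma mul_scale_delta_mx i j p l r s :
  (r *: delta_mx i j) *m (s *: delta_mx p l) =
  if j == p then (r * s) *: delta_mx i l else 0 :> 'M[R]_k.
Proof.
apply/matrixP => x y; rewrite mxE (bigD1 j) //= big1 => [|z neq_zj].
  rewrite !mxE eqxx andbT addr0; case: (j =P p) => _.
    rewrite !mxE /=; case: (x == i); case: (y == l);
      by rewrite ?mulr1 ?mulr0 ?mul0r.
  by rewrite /= !mulr0 mxE.
by rewrite !mxE (negbTE neq_zj) andbF mulr0 mul0r.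
Qed.

Lemma elem_mx0 i j : elem_mx i j 0 = 1%:M :> 'M[R]_k.
Proof. by rewrite /elem_mx scale0r addr0. Qed.

Lemma elem_mxD i j r s :
  i != j -> elem_mx i j (r + s) = elem_mx i j r *m elem_mx i j s.
Proof.
move=> neq_ij; rewrite /elem_mx mulmxDl !mulmxDr !mul1mx mulmx1.
rewrite mul_scale_delta_mx eq_sym (negbTE neq_ij) addr0 scalerDl.
by rewrite [RHS]addrAC addrA.
Qed.

Lemma elem_mx_comm i j p l r s : j != p -> i != l ->
  elem_mx i j r *m elem_mx p l s = elem_mx p l s *m elem_mx i j r.
Proof.
move=> neq_jp neq_il; rewrite /elem_mx !mulmxDl !mulmxDr !mul1mx !mulmx1.
rewrite !mul_scale_delta_mx (negbTE neq_jp) eq_sym (negbTE neq_il) !addr0.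
by rewrite addrAC.
Qed.

Lemma elem_mx_commutator i j l r s : i != j -> j != l -> i != l ->
  elem_mx i j r *m elem_mx j l s =
  elem_mx j l s *m elem_mx i j r *m elem_mx i l (r * s).
Proof.
move=> neq_ij neq_jl neq_il.
rewrite /elem_mx !mulmxDl !mulmxDr !mul1mx !mulmx1 !mulmxDl ?mul1mx.
rewrite !mul_scale_delta_mx eqxx.
rewrite ![_ == i]eq_sym (negbTE neq_ij) (negbTE neq_il) mul0mx !addr0.
rewrite -!addrA; congr (_ + _); rewrite addrC -!addrA; congr (_ + _).
Qed.

Lemma elem_mx_eq1 i j r : i != j -> elem_mx i j r = 1%:M -> r = 0.
Proof.
move=> neq_ij /matrixP/(_ i j).
by rewrite !mxE (negbTE neq_ij) !eqxx mulr1 add0r.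
Qed.

Lemma elem_mx_GL i j r : i != j -> GL (elem_mx i j r).
Proof.
move=> neq_ij; exists (elem_mx i j (- r)).
by rewrite -!elem_mxD // subrr addNr elem_mx0.
Qed.

Lemma GL_is_subgroup : GL_subgroup (@GL R k).
Proof.
split=> [//||A B [A' [AA' A'A]] [B' [BB' B'B]]|A B _ AB BA].
- by exists 1%:M; rewrite mulmx1.
- exists (B' *m A'); rewrite mulmxA -(mulmxA A) BB' mulmx1 AA'.
  by rewrite mulmxA -(mulmxA B') A'A mulmx1 B'B.
- by exists A.
Qed.

Lemma EL_subgroup : GL_subgroup (EL R k).
Proof.
split=> [A EA|H [[_ H1 _ _] _]|A B EA EB H sH|A B EA AB BA H sH] //.
- apply: EA; split; first exact: GL_is_subgroup.
  by move=> _ [i [j [r [neq_ij ->]]]]; exact: elem_mx_GL.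
- by case: (sH) => [[_ _ HM _] _]; apply: HM; [exact: EA|exact: EB].
- by case: (sH) => [[_ _ _ HV] _]; apply: HV AB BA; exact: EA.
Qed.

Lemma elem_mx_EL i j r : i != j -> EL R k (elem_mx i j r).
Proof. by move=> neq_ij H [_]; apply; exists i, j, r. Qed.

End ElementaryRelations.

(** * Images of the root subgroups under a representation *)

Section RootSubgroups.
Variables (R : pzRingType) (k : nat) (K : fieldType) (n : nat).
Variable rho : 'M[R]_k -> 'M[K]_n.+1.
Hypothesis rhoM : {in EL R k &, {morph rho : A B / A *m B}}.
Hypothesis rhoG : {homo rho : A / EL R k A >-> GL A}.
Hypothesis rhoI : {in EL R k &, injective rho}.
Implicit Types (i j l : 'I_k) (r s : R).

Definition root_mx i j r : 'M[K]_n.+1 := rho (elem_mx i j r).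
Local Notation X := root_mx.

Let rhoME A B : EL R k A -> EL R k B -> rho (A *m B) = rho A * rho B.
Proof. by move=> EA EB; rewrite rhoM //; exact: mem_set. Qed.

Let rho1 : rho 1%:M = 1.
Proof.
have E1 : EL R k 1%:M by have [] := EL_subgroup R k.
have [B [rB _]] := rhoG E1.
have := rhoME E1 E1; rewrite mulmx1 => /(congr1 (mulmx^~ B)).
by rewrite -mulmxE -mulmxA rB mulmx1 => /esym.
Qed.

Lemma root_mx0 i j : X i j 0 = 1.
Proof. by rewrite /X elem_mx0 rho1. Qed.

Lemma root_mxD i j r s : i != j -> X i j (r + s) = X i j r * X i j s.
Proof.
by move=> neq_ij; rewrite /X elem_mxD // rhoME //; exact: elem_mx_EL.
Qed.

Lemma root_mxV i j r : i != j -> (X i j r)^-1 = X i j (- r).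
Proof.
move=> neq_ij; have XN : X i j r * X i j (- r) = 1.
  by rewrite -root_mxD // subrr root_mx0.
have NX : X i j (- r) * X i j r = 1 by rewrite -root_mxD // addNr root_mx0.
have uX : X i j r \is a GRing.unit by apply/unitrP; exists (X i j (- r)).
by apply: (mulrI uX); rewrite XN divrr.
Qed.

Lemma root_mx_unit i j r : i != j -> X i j r \is a GRing.unit.
Proof.
move=> neq_ij; apply/unitrP; exists (X i j (- r)).
by rewrite -!root_mxD // subrr addNr root_mx0.
Qed.

Lemma root_mxMn i j r m : i != j -> X i j (r *+ m) = X i j r ^+ m.
Proof.
move=> neq_ij; elim: m => [|m IHm]; first by rewrite mulr0n root_mx0.
by rewrite mulrS exprS root_mxD // IHm.
Qed.

Lemma root_mx_comm i j p l r s : i != j -> p != l -> j != p -> i != l ->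
  GRing.comm (X i j r) (X p l s).
Proof.
move=> neq_ij neq_pl neq_jp neq_il.
have Eij := elem_mx_EL r neq_ij; have Epl := elem_mx_EL s neq_pl.
by rewrite /GRing.comm -(rhoME Eij Epl) -(rhoME Epl Eij) elem_mx_comm.
Qed.

Lemma root_mx_commutator i j l r s : i != j -> j != l -> i != l ->
  X i j r * X j l s = X j l s * X i j r * X i l (r * s).
Proof.
move=> neq_ij neq_jl neq_il.
have Eij := elem_mx_EL r neq_ij; have Ejl := elem_mx_EL s neq_jl.
have Eil := elem_mx_EL (r * s) neq_il.
have EE : EL R k (elem_mx j l s *m elem_mx i j r).
  by have [_ _ EM _] := EL_subgroup R k; exact: EM.
rewrite -(rhoME Eij Ejl) -(rhoME Ejl Eij) -(rhoME EE Eil).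
by rewrite elem_mx_commutator.
Qed.

Lemma root_mx_eq1 i j r : i != j -> X i j r = 1 -> r = 0.
Proof.
move=> neq_ij; rewrite -rho1 => /rhoI X1; apply: (elem_mx_eq1 neq_ij).
by apply: X1; apply: mem_set; [exact: elem_mx_EL|have [] := EL_subgroup R k].
Qed.

Lemma root_mxJr i j l r s : i != j -> j != l -> i != l ->
  (X j l s)^-1 * X i j r * X j l s = X i j r * X i l (r * s).
Proof.
move=> neq_ij neq_jl neq_il.
by rewrite -mulrA root_mx_commutator // -mulrA mulKr // root_mx_unit.
Qed.

(** The parameter is negated so that [X l i s] itself stands on the left, giving [s * r] without a
    sign. *)
Lemma root_mxJl i j l r s : i != j -> l != i -> l != j ->
  (X l i (- s))^-1 * X i j r * X l i (- s) = X i j r * X l j (s * r).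
Proof.
move=> neq_ij neq_li neq_lj; rewrite root_mxV // opprK root_mx_commutator //.
have c : GRing.comm (X l i s) (X l j (s * r)).
  by apply: root_mx_comm; rewrite // eq_sym.
by rewrite -mulrA c -!mulrA -root_mxD // subrr root_mx0 mulr1.
Qed.

Lemma root_mx_unipotentMn i j r : (2 < k)%N -> i != j ->
  unipotent (X i j (r *+ (n.+1)`!)).
Proof.
move=> k_gt2 neq_ij.
(* A third index [l] makes [X i l r] and [X l j 1] a Heisenberg pair whose commutator is
   [X i j r]. *)
have [l _] : exists2 l, l \in [set: 'I_k] & l \notin [set i; j].
  apply/subsetPn; move: k_gt2; apply: contraTN => /subset_leq_card.
  by rewrite cardsT card_ord cards2 neq_ij -leqNgt.
rewrite !inE negb_or => /andP[neq_li neq_lj]; rewrite root_mxMn //; apply/eqP.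
apply: (@heisenberg_unipotent _ _ (X i l r) (X l j 1)).
- by rewrite root_mx_unit // eq_sym.
- by rewrite root_mx_unit.
- by apply: root_mx_comm; rewrite // eq_sym.
- by apply: root_mx_comm; rewrite // eq_sym.
rewrite root_mx_commutator // 1?eq_sym // mulr1.
have c : GRing.comm (X i j r) (X l j 1 * X i l r).
  by apply: commrM; apply: root_mx_comm; rewrite // eq_sym.
by rewrite -c mulrA.
Qed.

(** [X i l (r * s)] is the inverse of the unipotent [X i j r] times a conjugate of it, and these two
    factors commute. *)
Lemma unipotent_root_mxMr i j l r s : i != j -> j != l -> i != l ->
  unipotent (X i j r) -> unipotent (X i l (r * s)).
Proof.
move=> neq_ij neq_jl neq_il uX.
have -> : X i l (r * s) = (X i j r)^-1 * ((X j l s)^-1 * X i j r * X j l s).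
  by rewrite root_mxJr // mulKr // root_mx_unit.
apply: unipotentM; last by rewrite unipotentJ // root_mx_unit.
  rewrite root_mxJr // root_mxV // -root_mxV //.
  apply/commrM; apply/commr_sym/commrV => //.
  by apply: root_mx_comm; rewrite // eq_sym.
exact: unipotentV.
Qed.

Lemma unipotent_root_mxMl i j l r s : i != j -> l != i -> l != j ->
  unipotent (X i j r) -> unipotent (X l j (s * r)).
Proof.
move=> neq_ij neq_li neq_lj uX.
have -> : X l j (s * r) =
    (X i j r)^-1 * ((X l i (- s))^-1 * X i j r * X l i (- s)).
  by rewrite root_mxJl // mulKr // root_mx_unit.
apply: unipotentM; last by rewrite unipotentJ // root_mx_unit.
  rewrite root_mxJl //.
  apply/commrM; apply/commr_sym/commrV => //.
  by apply: root_mx_comm; rewrite // eq_sym.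
exact: unipotentV.
Qed.

Lemma unipotent_root_ideal a b c : a != b -> b != c -> a != c ->
  two_sided_ideal (fun r => unipotent (X a c r)).
Proof.
move=> neq_ab neq_bc neq_ac; split=> [|r s ur us|s r ur].
- by rewrite root_mx0 unipotent1.
- rewrite root_mxD // -root_mxV //; apply: unipotentM => //.
    by apply/commrV/root_mx_comm; rewrite // eq_sym.
  exact: unipotentV.
- split.
    (* Each multiplication changes an index, so the left one goes through the root [(b, c)] and
       returns with a factor 1; the right one goes through [(a, b)]. *)
    rewrite -[s * r]mul1r; apply: (@unipotent_root_mxMl b) => //.
    by apply: (@unipotent_root_mxMl a) => //; rewrite eq_sym.
  rewrite -[r]mulr1; apply: (@unipotent_root_mxMr _ b) => //.
  by apply: (@unipotent_root_mxMr _ c) => //; rewrite eq_sym.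
Qed.

End RootSubgroups.

(** * A representation of the ring in characteristic zero *)

Section RingRepresentation.
Variables (R : pzRingType) (k : nat) (K : fieldType) (n : nat).
Variable rho : 'M[R]_k -> 'M[K]_n.+1.
Hypothesis rhoM : {in EL R k &, {morph rho : A B / A *m B}}.
Hypothesis rhoG : {homo rho : A / EL R k A >-> GL A}.
Hypothesis rhoI : {in EL R k &, injective rho}.
Hypothesis K0 : [pchar K] =i pred0.
Variables a b c : 'I_k.
Hypotheses (neq_ab : a != b) (neq_bc : b != c) (neq_ac : a != c).

Local Notation X := (root_mx rho).
Local Notation U r := (unipotent (X a c r)).

Let U_ideal : two_sided_ideal (fun r => U r).
Proof. exact: (unipotent_root_ideal rhoM rhoG neq_ab neq_bc neq_ac). Qed.

Let L r : 'rV[K]_(n.+1 * n.+1) := mxvec (log_mx (X a c r)).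

Let LD r s : U r -> U s -> L (r + s) = L r + L s.
Proof.
move=> ur us; rewrite /L (root_mxD rhoM) // log_mxM // ?linearD //.
by apply: (root_mx_comm rhoM); rewrite // eq_sym.
Qed.

Let L0_eq0 r : U r -> L r = 0 -> r = 0.
Proof.
move=> ur Lr; apply: (root_mx_eq1 rhoM rhoG rhoI neq_ac).
apply: log_mx_eq0 => //; apply: (can_inj mxvecK); rewrite linear0; exact: Lr.
Qed.

Let LMn r m : U r -> L (r *+ m) = L r *+ m.
Proof.
move=> ur; elim: m => [|m IHm].
  have u0 : U 0 by case: U_ideal.
  have := LD u0 u0; rewrite addr0 => /eqP.
  by rewrite -subr_eq0 opprD addNKr oppr_eq0 !mulr0n => /eqP.
rewrite !mulrS LD ?IHm //; rewrite (root_mxMn rhoM rhoG) //.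
elim: m {IHm} => [|m IHm]; first exact: unipotent1.
rewrite exprS; apply: unipotentM => //; exact/commrX.
Qed.

(** [L] embeds the ideal additively into a vector space over a field of characteristic zero. *)
Lemma torsion_free_unipotent_ideal r m :
  (0 < m)%N -> U r -> r *+ m = 0 -> r = 0.
Proof.
move=> m_gt0 ur rm; apply: L0_eq0 => //; have := LMn m ur.
have -> : L (r *+ m) = 0 by rewrite rm -(mulr0n 0) LMn //; case: U_ideal.
move/esym/eqP; rewrite -scaler_nat scaler_eq0 => /orP[|/eqP //].
by have /pcharf0P-> := K0; case: m m_gt0 {rm}.
Qed.

Let D g : 'M[K]_(n.+1 * n.+1) := lin_mulmx g^-1 *m lin_mulmxr g - 1%:M.

Let mul_vec_D g v : mxvec v *m D g = mxvec (g^-1 * v * g - v).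
Proof.
by rewrite mulmxBr mulmx1 mulmxA !mul_vec_lin /= linearB.
Qed.

(** Conjugating [X i j r] multiplies it by the commuting [X i l (r * s)]; the logarithm respects
    both operations, so subtracting the original leaves the logarithm of the new factor. *)
Let L_commutator i j l r s : i != j -> j != l -> i != l ->
  unipotent (X i j r) ->
  mxvec (log_mx (X i j r)) *m D (X j l s) = mxvec (log_mx (X i l (r * s))).
Proof.
move=> neq_ij neq_jl neq_il ur; rewrite mul_vec_D -log_mxJ; last first.
  exact: (root_mx_unit rhoM rhoG).
rewrite (root_mxJr rhoM rhoG) // log_mxM //; first by rewrite addrC addKr.
  by apply: (root_mx_comm rhoM); rewrite // eq_sym.
exact: (unipotent_root_mxMr rhoM rhoG s neq_ij).
Qed.

(* On the span of the logarithms of [X a c r], right multiplication by [s] is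
   induced by the linear map [v |-> h^-1 v h - v] for [h = X c b 1] followed by
   that for [h = X b c s]. *)
Lemma EL_rep_ring_rep : (2 < k)%N ->
  exists m (phi : {rmorphism R -> 'M[K]_m}),
    forall s, phi s = 0 -> s *+ (n.+1)`! = 0.
Proof.
move=> k_gt2.
have neq_cb : c != b by rewrite eq_sym.
have UMr r s : U r -> U (r * s).
  by case: U_ideal => _ _ UM ur; case: (UM s r ur).
have LM r s : U r -> L r *m (D (X c b 1) *m D (X b c s)) = L (r * s).
  move=> ur; rewrite mulmxA L_commutator // mulr1 L_commutator //.
  rewrite -[r]mulr1; exact: (unipotent_root_mxMr rhoM rhoG 1 neq_ac).
have [m [phi phiP]] := @linear_action R K _ (fun r => U r) L _ UMr LD LM.
exists m, phi => s /phiP Ls; set N := (n.+1)`!.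
(* The integer [N] lies in the ideal, so a kernel element [s] can be tested against it:
   [L (N s) = 0]. *)
have uN : U (N%:R) by exact: (root_mx_unipotentMn rhoM rhoG).
rewrite -mulr_natl; apply: L0_eq0; [exact: UMr|exact: Ls].
Qed.

End RingRepresentation.

(** * Finite index of the unipotent ideal *)

(** Infinitely many cosets would include [m] distinct ones, whose representatives are pairwise
    incongruent. *)
Lemma finite_index_pigeonhole (R : pzRingType) (I : set R) (m : nat) :
  two_sided_ideal I ->
  (forall f : 'I_m -> R, exists i j, i != j /\ I (f i - f j)) ->
  finite_index I.
Proof.
move=> [I0 IB _] pigeon; apply: contrapT => /(infinite_set_fset m)[B BI leB].
pose F (i : 'I_m) := nth set0 (enum_fset B) i.
have ltB (i : 'I_m) : (i < size (enum_fset B))%N by exact: leq_trans leB.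
have FI i : exists r, [set s | I (s - r)]%classic = F i.
  have [r _ rF] : cosets I (F i) by apply: BI; exact: mem_nth.
  by exists r.
have [f fF] := choice FI.
have [i [j [neq_ij Iij]]] := pigeon f.
have : F i = F j.
  rewrite -!fF; apply/seteqP; split=> s /= Is.
    have -> : s - f j = (s - f i) - (0 - (f i - f j)).
      by rewrite sub0r opprK addrA subrK.
    by apply: (IB _ _ Is); exact: IB.
  have -> : s - f i = (s - f j) - (f i - f j) by rewrite opprB addrA subrK.
  exact: IB.
move/eqP; rewrite nth_uniq ?fset_uniq // => /eqP/val_inj eq_ij.
by rewrite eq_ij eqxx in neq_ij.
Qed.

Section FiniteIndex.
Variables (R : pzRingType) (k : nat) (C : numClosedFieldType) (n : nat).
Variable rho : 'M[R]_k -> 'M[C]_n.+1.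
Hypothesis rhoM : {in EL R k &, {morph rho : A B / A *m B}}.
Hypothesis rhoG : {homo rho : A / EL R k A >-> GL A}.
Variables a b c : 'I_k.
Hypotheses (neq_ab : a != b) (neq_bc : b != c) (neq_ac : a != c).
Local Notation X := (root_mx rho).

(* The commuting matrices [X a c r] are simultaneously triangular; their
   diagonal entries are roots of unity of bounded order, so that finitely many
   diagonals occur, and equal diagonals mean congruent parameters. *)
Lemma finite_index_unipotent_ideal :
  finite_index (fun r => unipotent (X a c r)).
Proof.
set N := (n.+1)`!.
have N_gt0 : (0 < N)%N by exact: fact_gt0.
pose p : {poly C} := 'X^N - 1.
have [rs pE] := closed_field_poly_normal p.
have p0 : p != 0 by rewrite -size_poly_eq0 size_XnsubC.
have rsP x : x ^+ N = 1 -> x \in rs.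
  move=> xN; have: root p x by rewrite rootE !hornerE xN subrr.
  by rewrite pE rootZ ?lead_coef_eq0 // root_prod_XsubC.
have U_ideal := unipotent_root_ideal rhoM rhoG neq_ab neq_bc neq_ac.
(* A diagonal is recorded by positions in [rs]; [index] returns [size rs] for a missing entry,
   whence the successor. *)
pose T := {ffun 'I_n.+1 -> 'I_(size rs).+1}.
apply: (@finite_index_pigeonhole _ _ #|T|.+1 U_ideal) => f.
have k_gt2 : (2 < k)%N.
  have := max_card [set a; b; c].
  rewrite card_ord; apply: leq_trans.
  by rewrite -finset.setUA !cardsU1 cards1 !inE negb_or neq_ab neq_ac neq_bc.
have comX r s : GRing.comm (X a c r) (X a c s).
  by apply: (root_mx_comm rhoM); rewrite // eq_sym.
have [|P] := @cotrigonalization C n.+1 [seq X a c (f i) | i <- enum 'I_#|T|.+1].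
  by move=> _ _ /mapP[i _ ->] /mapP[j _ ->]; exact: comX.
move=> /unitarymx_unit uP /allP/= trigP.
pose t i := P * X a c (f i) * P^-1.
have trig_t i : is_trig_mx (t i).
  by have := trigP _ (map_f _ (mem_enum _ i)); rewrite /similar_to conjumx.
have tN i j : t i j j ^+ N = 1.
  have uXN : (X a c (f i) ^+ N - 1) ^+ n.+1 = 0.
    have := root_mx_unipotentMn rhoM rhoG (f i) k_gt2 neq_ac.
    by rewrite (root_mxMn rhoM rhoG) // => /eqP.
  (* Diagonal entries of a triangular matrix are eigenvalues, hence roots of the minimal
     polynomial. *)
  have : mxminpoly (t i) %| p ^+ n.+1.
    apply: mxminpoly_min; rewrite horner_mx_uconj //.
    rewrite rmorphXn rmorphB rmorph1 rmorphXn /= horner_mx_X uXN.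
    by rewrite mulmx0 mul0mx.
  have : root (mxminpoly (t i)) (t i j j).
    rewrite root_mxminpoly char_poly_trig // /root horner_prod.
    by rewrite (bigD1 j) //= hornerXsubC subrr mul0r.
  move=> rt /dvdpP[q /(congr1 (horner^~ (t i j j)))].
  rewrite hornerM (rootP rt) mulr0 horner_exp => /eqP.
  by rewrite expf_eq0 /= !hornerE subr_eq0 => /eqP.
pose d (i : 'I_#|T|.+1) : T := [ffun j => inord (index (t i j j) rs)].
have /injectivePn[i [j neq_ij eq_d]] : ~~ injectiveb d.
  apply/injectiveP => /leq_card; rewrite card_ord.
  by rewrite ltnn.
exists i, j; split=> //.
have eq_diag x : t i x x = t j x x.
  have /ffunP/(_ x) := eq_d; rewrite !ffunE => /(congr1 val).
  rewrite /= !inordK ?ltnS ?index_size // => eq_index.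
  by rewrite -(nth_index 0 (rsP _ (tN i x))) eq_index nth_index // rsP.
rewrite (root_mxD rhoM) // -(root_mxV rhoM rhoG) //.
apply/unipotentP; exists n.+1.
have uX r : X a c r \is a GRing.unit by exact: (root_mx_unit rhoM rhoG).
have -> : X a c (f i) * (X a c (f j))^-1 - 1 =
    (X a c (f i) - X a c (f j)) * (X a c (f j))^-1 by rewrite mulrBl divrr.
rewrite exprMn_comm; last first.
  by apply/commrV/commr_sym/commrB; exact: comX.
suff -> : (X a c (f i) - X a c (f j)) ^+ n.+1 = 0 by rewrite mul0r.
(* The difference is triangular with zero diagonal, so its characteristic polynomial is
   ['X^(n+1)]. *)
have t0 : (t i - t j) ^+ n.+1 = 0.
  have := Cayley_Hamilton (t i - t j).
  rewrite char_poly_trig; last first.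
    apply/is_trig_mxP => x y lt_xy.
    rewrite mxE [(- t j) x y]mxE.
    by rewrite (is_trig_mxP (trig_t i)) // (is_trig_mxP (trig_t j)) // subrr.
  under eq_bigr => x _ do
    rewrite [(t i - t j) x x]mxE [(- t j) x x]mxE eq_diag subrr subr0.
  by rewrite prodr_const card_ord rmorphXn /= horner_mx_X.
have uP' : P^-1 \is a GRing.unit by rewrite unitrV.
apply: (mulrI (_ : P^-1^-1 \is a GRing.unit)); first by rewrite unitrV.
apply: (mulIr uP'); rewrite -exprJ // mulr0 mul0r -t0 invrK.
by rewrite mulrBr mulrBl.
Qed.


End FiniteIndex.

(** * From ideals back to the elementary group *)

Lemma two_sided_idealD (R : pzRingType) (I : set R) :
  two_sided_ideal I -> forall r s, I r -> I s -> I (r + s).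
Proof.
move=> [I0 IB _] r s Ir Is; rewrite -[s]opprK -[- s]sub0r.
exact: (IB _ _ Ir (IB _ _ I0 Is)).
Qed.

Section MatrixMonoidReps.
Variables (R : pzRingType) (K : fieldType) (k : nat).

Lemma ring_rep_mx_rep (n : nat) (psi : R -> 'M[K]_n) :
  {morph psi : r s / r + s} -> {morph psi : r s / r * s >-> r *m s} ->
  exists d (sigma : 'M[R]_k -> 'M[K]_d),
    [/\ sigma 1%:M = 1%:M, {morph sigma : A B / A *m B}
      & forall A B, sigma A = sigma B -> forall i j, psi (A i j - B i j) = 0].
Proof.
move=> psiD psiM.
have psi0 : psi 0 = 0.
  have /eqP := psiD 0 0; rewrite addr0 -subr_eq0 opprD addNKr oppr_eq0.
  by move/eqP.
have psiN r : psi (- r) = - psi r.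
  by apply/eqP; rewrite -addr_eq0 -psiD addNr psi0.
pose Psi (A : 'M[R]_k) : 'M[K]_(\sum_(i < k) n) :=
  \mxblock_(i < k, j < k) psi (A i j).
have PsiD : {morph Psi : A B / A + B}.
  move=> A B; rewrite /Psi -mxblockD; apply: eq_mxblock => i j.
  by rewrite mxE psiD.
have PsiM : {morph Psi : A B / A *m B}.
  move=> A B; rewrite /Psi mul_mxblock; apply: eq_mxblock => i j.
  by rewrite mxE (big_morph _ psiD psi0); apply: eq_bigr => l _.
(* [psi] need not preserve 1, so the blockwise map is applied to [A - 1] and the identity is added
   back. *)
exists _, (fun A => 1%:M + Psi (A - 1%:M)); split=> [|A B|A B].
- rewrite subrr (_ : Psi 0 = 0) ?addr0 // -[RHS]mxblock0.
  by apply: eq_mxblock => i j; rewrite mxE psi0.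
- rewrite mulmxDl !mulmxDr !mul1mx mulmx1 -PsiM -[RHS]addrA; congr (_ + _).
  rewrite -!PsiD; congr Psi.
  rewrite (mulmxBr (A - 1%:M)) mulmx1 [A - _ + _]addrC subrK.
  by rewrite mulmxBl mul1mx [RHS]addrC addrA subrK.
- move=> /addrI; rewrite /Psi => /eq_mxblockP eqAB i j; apply/eqP.
  rewrite psiD psiN subr_eq0; apply/eqP; have := eqAB i j.
  by rewrite !mxE !psiD => /addIr.
Qed.

(** Presents [R / I] as a finite type with a section, on which functions can be enumerated. *)
Lemma finite_index_repr (I : set R) : two_sided_ideal I -> finite_index I ->
  exists (T : finType) (c : R -> T) (repr : T -> R),
    cancel repr c /\ forall r s, c r = c s <-> I (r - s).
Proof.
move=> [I0 IB _] /finite_fsetP[B BE].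
pose coset (r : R) : set R := [set s | I (s - r)]%classic.
have cosetP r s : coset r = coset s <-> I (r - s).
  split=> [eq_rs|Irs].
    have : coset r r by rewrite /coset /= subrr.
    by rewrite eq_rs.
  have Isr : I (s - r) by rewrite -[s - r]opprB -sub0r; exact: IB.
  rewrite /coset; apply/seteqP; split=> t /= It.
    have -> : t - s = (t - r) - (s - r) by rewrite opprB addrA subrK.
    exact: IB.
  have -> : t - r = (t - s) - (r - s) by rewrite opprB addrA subrK.
  exact: IB.
have inB r : coset r \in B.
  by have : [set` B]%classic (coset r) by rewrite -BE; exists r.
have hrepr (x : B) : exists r, coset r = val x.
  have : [set` B]%classic (val x) by exact: fsvalP.
  by rewrite -BE => -[r _ <-]; exists r.
have [repr reprP] := choice hrepr.
exists B, (fun r => FSetSub (inB r)), repr; split=> [x|r s].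
  by apply: val_inj; rewrite /= reprP.
rewrite -cosetP; split=> [/(congr1 val)//|eq_rs].
exact: val_inj.
Qed.

(** Matrices act on the finite set [(R / I)^k], computed through representatives; [sigma A] is the
    0-1 matrix of this self-map. *)
Lemma finite_index_mx_rep (I : set R) : two_sided_ideal I -> finite_index I ->
  exists d (sigma : 'M[R]_k -> 'M[K]_d),
    [/\ sigma 1%:M = 1%:M, {morph sigma : A B / A *m B}
      & forall A B, sigma A = sigma B -> forall i j, I (A i j - B i j)].
Proof.
move=> idealI /(finite_index_repr idealI)[T [c [repr [reprK cP]]]].
have [I0 IB IM] := idealI.
have ID := two_sided_idealD idealI.
have eqI r : I (repr (c r) - r) by apply/cP; rewrite reprK.
have Isum (F : 'I_k -> R) : (forall i, I (F i)) -> I (\sum_i F i).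
  by move=> IF; elim/big_ind: _.
pose act (A : 'M[R]_k) (v : {ffun 'I_k -> T}) :=
  [ffun i => c (\sum_j A i j * repr (v j))].
have act1 v : act 1%:M v = v.
  apply/ffunP => i; rewrite ffunE (bigD1 i) //= big1 => [|j neq_ji].
    by rewrite mxE eqxx mul1r addr0 reprK.
  by rewrite mxE eq_sym (negbTE neq_ji) mul0r.
have actM A B v : act (A *m B) v = act A (act B v).
  apply/ffunP => i; rewrite !ffunE; apply/cP.
  under eq_bigr do rewrite mxE mulr_suml.
  rewrite exchange_big -sumrB; apply: Isum => j.
  rewrite (_ : \sum_j0 _ = A i j * \sum_l B j l * repr (v l)); last first.
    by rewrite mulr_sumr; apply: eq_bigr => l _; rewrite mulrA.
  rewrite -mulrBr ffunE; apply: (proj1 (IM _ _ _)).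
  by rewrite -opprB -sub0r; apply: IB.
have act_inj A B : (forall v, act A v = act B v) ->
    forall i j, I (A i j - B i j).
  (* Acting on the [j]-th standard basis vector modulo [I] recovers column [j] modulo [I]. *)
  move=> eqAB i j; pose v := [ffun l => c (l == j)%:R] : {ffun 'I_k -> T}.
  have Iact (D : 'M[R]_k) : I (repr (act D v i) - D i j).
    have -> : D i j = \sum_l D i l * (l == j)%:R.
      rewrite (bigD1 j) //= eqxx mulr1 big1 ?addr0 // => l /negbTE->.
      by rewrite mulr0.
    have -> : repr (act D v i) - \sum_l D i l * (l == j)%:R =
        (repr (act D v i) - \sum_l D i l * repr (v l)) +
        \sum_l D i l * (repr (v l) - (l == j)%:R).
      under [X in _ = _ + X]eq_bigr do rewrite mulrBr.
      by rewrite sumrB addrA subrK.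
    apply: ID; first by rewrite ffunE.
    apply: Isum => l; rewrite ffunE; exact: (proj1 (IM _ _ _)).
  have -> : A i j - B i j =
      (repr (act B v i) - B i j) - (repr (act A v i) - A i j).
    by rewrite eqAB opprB [RHS]addrC addrA subrK.
  exact: IB.
pose W := {ffun 'I_k -> T}.
exists #|{: W}|,
  (fun A => \matrix_(x, y) (enum_val x == act A (enum_val y))%:R).
split=> [|A B|A B eqAB].
- by apply/matrixP => x y; rewrite !mxE act1 (inj_eq enum_val_inj).
- apply/matrixP => x y; rewrite !mxE actM.
  rewrite (bigD1 (enum_rank (act B (enum_val y)))) //= !mxE enum_rankK eqxx.
  rewrite mulr1 big1 ?addr0 // => z neq_z; rewrite !mxE.
  have /negbTE-> : enum_val z != act B (enum_val y).
    by apply: contra neq_z => /eqP<-; rewrite enum_valK.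
  by rewrite mulr0.
apply: act_inj => v.
have /matrixP/(_ (enum_rank (act A v)) (enum_rank v)) := eqAB.
rewrite !mxE !enum_rankK eqxx; case: eqP => // _ /eqP.
by rewrite oner_eq0.
Qed.

End MatrixMonoidReps.

(** Two of the integers [0, ..., #|T|] are congruent modulo [I]; their difference is the required
    [N]. *)
Lemma finite_index_natr (R : pzRingType) (I : set R) :
  two_sided_ideal I -> finite_index I -> exists2 N, (0 < N)%N & I N%:R.
Proof.
move=> idealI /(finite_index_repr idealI)[T [c [_ [_ cP]]]].
pose f (i : 'I_#|T|.+1) := c (i : nat)%:R.
have /injectivePn[i [j neq_ij /cP Iij]] : ~~ injectiveb f.
  by apply/injectiveP => /leq_card; rewrite card_ord ltnn.
case: idealI => I0 IB _.
have Iji : I ((j : nat)%:R - (i : nat)%:R) by rewrite -opprB -sub0r; exact: IB.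
have [lt_ij|lt_ji|eq_ij] := ltngtP i j.
- by exists (j - i)%N; rewrite ?subn_gt0 // natrB // ltnW.
- by exists (i - j)%N; rewrite ?subn_gt0 // natrB // ltnW.
- by move/val_inj: eq_ij neq_ij => ->; rewrite eqxx.
Qed.

(* Dividing [phi (N r)] by [N] extends [phi] from the ideal to the whole ring;
   the information lost on [R / I] is recovered from the permutation action of
   matrices on the finite set [(R / I)^k]. *)
Lemma faithful_ideal_rep_EL (R : pzRingType) (K : fieldType) (k : nat)
    (I : set R) :
  [pchar K] =i pred0 -> two_sided_ideal I -> finite_index I ->
  faithful_ideal_rep I K -> faithful_group_rep (EL R k) K.
Proof.
move=> K0 idealI finI [n [phi [phiD' phiM' phiI']]].
have [I0 IB IM] := idealI.
have [N N_gt0 IN] := finite_index_natr idealI finI.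
have phiD r s : I r -> I s -> phi (r + s) = phi r + phi s.
  by move=> Ir Is; apply: phiD'; exact: mem_set.
have phiM r s : I r -> I s -> phi (r * s) = phi r *m phi s.
  by move=> Ir Is; apply: phiM'; exact: mem_set.
have ID := two_sided_idealD idealI.
have phi0 : phi 0 = 0.
  have /eqP := phiD _ _ I0 I0; rewrite addr0 -subr_eq0 opprD addNKr oppr_eq0.
  by move/eqP.
have IMn r m : I r -> I (r *+ m).
  by move=> Ir; elim: m => // m IHm; rewrite mulrS; exact: ID.
have phiMn r m : I r -> phi (r *+ m) = phi r *+ m.
  move=> Ir; elim: m => // m IHm; rewrite !mulrS phiD ?IHm //; exact: IMn.
have N_neq0 : N%:R != 0 :> K by have /pcharf0P-> := K0; rewrite -lt0n.
have IrN r : I (r *+ N) by rewrite -mulr_natl; case: (IM r _ IN).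
pose psi r := (N%:R : K)^-1 *: phi (r *+ N).
have psiD : {morph psi : r s / r + s}.
  by move=> r s; rewrite /psi mulrnDl phiD // scalerDr.
have psiM : {morph psi : r s / r * s >-> r *m s}.
  move=> r s; rewrite /psi -scalemxAl -scalemxAr -phiM //.
  rewrite mulrnAl mulrnAr (phiMn _ N (IrN _)) -scaler_nat !scalerA.
  by rewrite -mulrA mulVf // mulr1.
have psiI r : I r -> psi r = 0 -> r = 0.
  move=> Ir; rewrite /psi phiMn // -scaler_nat scalerA mulVf //.
  by rewrite scale1r -phi0 => /phiI'; apply; exact: mem_set.
have [d1 [s1 [s11 s1M s1I]]] := ring_rep_mx_rep k psiD psiM.
have [d2 [s2 [s21 s2M s2I]]] := finite_index_mx_rep K k idealI finI.
exists (d1 + d2)%N, (fun A => block_mx (s1 A) 0 0 (s2 A)).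
have sM A B : block_mx (s1 (A *m B)) 0 0 (s2 (A *m B)) =
    block_mx (s1 A) 0 0 (s2 A) *m block_mx (s1 B) 0 0 (s2 B).
  by rewrite mulmx_block !mulmx0 !mul0mx !addr0 !add0r s1M s2M.
have s1E : block_mx (s1 1%:M) 0 0 (s2 1%:M) = 1%:M.
  by rewrite s11 s21 -scalar_mx_block.
split=> [A EA|A B _ _|A B _ _].
- have [/(_ _ EA)[B [AB BA]] _ _ _] := EL_subgroup R k.
  by exists (block_mx (s1 B) 0 0 (s2 B)); rewrite -!sM AB BA.
- exact: sM.
(* The second block puts the entries of [A - B] in [I], the first makes [psi] kill them, and [psi]
   is injective on [I]. *)
- move=> /eq_block_mx[/s1I psi0 _ _ /s2I IAB].
  apply/matrixP => i j; apply/eqP; rewrite -subr_eq0; apply/eqP.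
  exact: psiI.
Qed.

(** * The linearity criterion *)

(** Adding a trivial one-dimensional summand gives positive dimension, where square matrices form a
    nontrivial ring. *)
Lemma faithful_group_rep_posdim (R : pzRingType) (k : nat) (K : fieldType)
    (G : set 'M[R]_k) :
  faithful_group_rep G K -> exists (n : nat) (rho : 'M[R]_k -> 'M[K]_n.+1),
    [/\ {homo rho : A / G A >-> GL A},
        {in G &, {morph rho : A B / A *m B}}
      & {in G &, injective rho}].
Proof.
move=> [n [rho [rhoG rhoM rhoI]]].
exists n; suff : exists rho' : 'M[R]_k -> 'M[K]_(1 + n),
  [/\ {homo rho' : A / G A >-> GL A}, {in G &, {morph rho' : A B / A *m B}}
    & {in G &, injective rho'}] by [].
exists (fun A => block_mx (1%:M : 'M_1) 0 0 (rho A)).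
split=> [A GA|A B GA GB|A B GA GB].
- have [B [AB BA]] := rhoG _ GA; exists (block_mx (1%:M : 'M_1) 0 0 B).
  by rewrite !mulmx_block !mulmx0 !mul0mx !addr0 !add0r AB BA mulmx1
    -scalar_mx_block.
- by rewrite mulmx_block !mulmx0 !mul0mx !addr0 !add0r rhoM // mulmx1.
- by move=> /eq_block_mx[_ _ _]; exact: rhoI.
Qed.

Lemma EL_faithful_iff (R : pzRingType) (C : numClosedFieldType) (k : nat) :
  (3 <= k)%N ->
  faithful_group_rep (EL R k) (C : fieldType) <->
  exists I : set R, [/\ two_sided_ideal I, finite_index I
                      & faithful_ideal_rep I (C : fieldType)].
Proof.
move=> k_gt2; split; last first.
  move=> [I [idealI finI repI]]; apply: faithful_ideal_rep_EL repI => //.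
  exact: Num.Theory.pchar_num.
case/faithful_group_rep_posdim=> n [rho [rhoG rhoM rhoI]].
have [a [b [c [neq_ab neq_bc neq_ac]]]] :
    exists a b c : 'I_k, [/\ a != b, b != c & a != c].
  by exists (Ordinal (ltnW (ltnW k_gt2))), (Ordinal (ltnW k_gt2)),
    (Ordinal k_gt2).
have idealU := unipotent_root_ideal rhoM rhoG neq_ab neq_bc neq_ac.
exists (fun r => unipotent (root_mx rho a c r)); split=> //.
  exact: (finite_index_unipotent_ideal rhoM rhoG neq_ab neq_bc neq_ac).
have C0 : [pchar C] =i pred0 by exact: Num.Theory.pchar_num.
have [m [phi phiP]] :=
  EL_rep_ring_rep rhoM rhoG rhoI C0 neq_ab neq_bc neq_ac k_gt2.
exists m, phi; split=> [r s _ _|r s _ _|r s /set_mem Ur /set_mem Us eq_rs].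
- exact: rmorphD.
- exact: rmorphM.
apply/eqP; rewrite -subr_eq0; apply/eqP.
have Urs : unipotent (root_mx rho a c (r - s)).
  by case: idealU => _ UB _; exact: UB.
(* [(n+1)!] kills the kernel of [phi], while the unipotent ideal has no torsion. *)
apply: (torsion_free_unipotent_ideal rhoM rhoG rhoI C0 neq_ab neq_bc neq_ac
  (fact_gt0 n.+1) Urs).
by apply: phiP; rewrite rmorphB eq_rs subrr.
Qed.

(** * The free ring satisfies no standard identity *)

Section StandardPolynomial.

Definition standard_poly (A : pzRingType) (d : nat) (a : 'I_d -> A) : A :=
  \sum_(s : 'S_d) (-1) ^+ s * \prod_(i < d) a (s i).

Lemma rmorph_standard_poly (A B : pzRingType) (f : {rmorphism A -> B}) d
    (a : 'I_d -> A) :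
  f (standard_poly a) = standard_poly (f \o a).
Proof.
rewrite /standard_poly rmorph_sum; apply: eq_bigr => s _.
by rewrite rmorphM rmorph_sign rmorph_prod.
Qed.

(* Expanding in the basis of matrix units, each coefficient is a determinant
   with two equal rows. *)
Lemma standard_poly_mx (K : fieldType) (m d : nat) (a : 'I_d -> 'M[K]_m.+1) :
  (m.+1 * m.+1 < d)%N -> standard_poly a = 0.
Proof.
move=> lt_d; pose T := ('I_m.+1 * 'I_m.+1)%type.
have aE i : a i = \sum_(p : T) a i p.1 p.2 *: delta_mx p.1 p.2.
  by rewrite [LHS]matrix_sum_delta pair_bigA.
pose E (f : {ffun 'I_d -> T}) : 'M[K]_m.+1 :=
  \prod_i delta_mx (f i).1 (f i).2.
pose M (f : {ffun 'I_d -> T}) := \matrix_(i < d, j < d) a j (f i).1 (f i).2.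
transitivity (\sum_f \det (M f) *: E f); last first.
  apply: big1 => f _; have /injectivePn[i [j neq_ij eq_f]] : ~~ injectiveb f.
    apply/injectiveP => /leq_card.
    by rewrite card_ord card_prod card_ord leqNgt lt_d.
  rewrite (determinant_alternate neq_ij) ?scale0r // => x.
  by rewrite !mxE eq_f.
under [RHS]eq_bigr do rewrite scaler_suml.
rewrite /standard_poly exchange_big; apply: eq_bigr => s _.
rewrite (eq_bigr _ (fun i _ => aE (s i))).
rewrite bigA_distr_bigA mulr_sumr; apply: eq_bigr => f _.
rewrite scaler_prod -scalerA [RHS]scaler_sign mulr_sign.
congr (if _ then - (_ *: _) else _ *: _); apply: eq_bigr => i _;
  by rewrite mxE.
Qed.

Let mon (w : seq bool) : free_ring2 := mkmalgU (FMonom w) 1.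

Let monM v w : mon v * mon w = mon (v ++ w).
Proof.
by rewrite /mon malgM_def fgmulUU mulr1; congr mkmalgU; exact: fmmulE.
Qed.

Let mon_prod (I : Type) (r : seq I) (w : I -> seq bool) :
  \prod_(i <- r) mon (w i) = mon (flatten [seq w i | i <- r]).
Proof.
elim: r => [|i r IHr]; last by rewrite big_cons IHr monM.
by rewrite big_nil /mon; congr mkmalgU; exact: fmoneE.
Qed.

(** The words [x^i y] form a prefix code, so a concatenation of them can be decoded. *)
Let code (i : nat) := rcons (nseq i true) false.

Let code_inj (r1 r2 : seq nat) : size r1 = size r2 ->
  flatten [seq code i | i <- r1] = flatten [seq code i | i <- r2] -> r1 = r2.
Proof.
have codeP i j (v w : seq bool) : code i ++ v = code j ++ w -> i = j /\ v = w.
  elim: i j => [|i IHi] [|j] //=; first by case.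
  by case=> /IHi[-> ->].
elim: r1 r2 => [|i r1 IHr] [|j r2] //= [sz] /codeP[-> eq_r].
by rewrite (IHr _ sz).
Qed.

(** By unique decoding, only the identity permutation contributes to the coefficient of the word
    [W], which is therefore 1. *)
Lemma standard_poly_free_ring2_neq0 d :
  exists a : 'I_d -> free_ring2, standard_poly a != 0.
Proof.
exists (fun i => mon (code i)); pose W := flatten [seq code i | i <- iota 0 d].
have prodE (s : 'S_d) : \prod_(i < d) mon (code (s i)) =
    mon (flatten [seq code i | i <- [seq val (s i) | i <- enum 'I_d]]).
  by rewrite -map_comp -mon_prod enumT.
set S := standard_poly _; suff coefW : mcoeff (FMonom W) S = 1.
  by apply/eqP => S0; move: coefW; rewrite S0 mcoeff0.
rewrite /S /standard_poly raddf_sum /= (bigD1 1%g) //=.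
rewrite [X in _ + X]big1 => [|s neq_s1].
  rewrite odd_perm1 expr0 mul1r addr0 prodE mcoeffU1 (_ : _ == _) //.
  apply/eqP; congr (FMonom (flatten (map _ _))).
  by rewrite -val_enum_ord; apply: eq_map => i; rewrite perm1.
have coef0 : mcoeff (FMonom W) (\prod_(i < d) mon (code (s i))) = 0.
  rewrite prodE mcoeffU1; case: eqP => // -[eqW]; case/eqP: neq_s1.
  have := @code_inj _ (iota 0 d) _ eqW.
  rewrite size_map size_enum_ord size_iota -val_enum_ord => /(_ erefl) eq_s.
  apply/permP => i; rewrite perm1; apply: val_inj.
  by have /eq_in_map/(_ i (mem_enum _ i)) := eq_s.
by case: (odd_perm s); rewrite ?mul1r ?mulN1r ?mcoeffN coef0 ?oppr0.
Qed.

End StandardPolynomial.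

Lemma free_ring2_not_linear (K : fieldType) (m : nat)
    (phi : {rmorphism free_ring2 -> 'M[K]_m}) : ~ injective phi.
Proof.
case: m phi => [|m] phi phi_inj.
  have : (1 : free_ring2) = 0.
    by apply: phi_inj; rewrite [LHS]thinmx0 [RHS]thinmx0.
  by move/eqP; rewrite oner_eq0.
(* The degree is one more than the dimension of the matrix algebra. *)
have [a /eqP[]] := standard_poly_free_ring2_neq0 (m.+1 * m.+1).+1.
by apply: phi_inj; rewrite rmorph_standard_poly standard_poly_mx ?rmorph0.
Qed.

(** * Nonlinearity over the free ring *)

(** By Frobenius [(X - 1)^(p^e) = X^(p^e) - 1], which vanishes once [p^e] exceeds the nilpotency
    exponent; [e = n + 1] suffices. *)
Lemma pchar_unipotent_exp (K : fieldType) (p n : nat) (X : 'M[K]_n.+1) :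
  p \in [pchar K] -> unipotent X -> X ^+ (p ^ n.+1) = 1.
Proof.
move=> pK /eqP uX.
have pM : p \in [pchar 'M[K]_n.+1] by rewrite pchar_lalg.
have frob e : (X - 1) ^+ (p ^ e) = X ^+ (p ^ e) - 1.
  elim: e => [|e IHe]; first by rewrite !expr1.
  rewrite expnSr exprM IHe -(pFrobenius_autE pM) pFrobenius_autB_comm.
    by rewrite !pFrobenius_autE expr1n -exprM.
  exact: commr1.
apply/eqP; rewrite -subr_eq0 -frob; apply/eqP/(expr_leq_eq0 _ uX).
by apply/ltnW/ltn_expl; exact: prime_gt1 (pcharf_prime pK).
Qed.

Lemma free_ring2_torsion_free (x : free_ring2) (m : nat) :
  (0 < m)%N -> x *+ m = 0 -> x = 0.
Proof.
move=> m_gt0 /malgP xm; apply/malgP => w; have := xm w.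
rewrite mcoeffMn mcoeff0 => /eqP.
by rewrite -mulr_natr mulf_eq0 Num.Theory.pnatr_eq0 eqn0Ngt m_gt0 orbF => /eqP.
Qed.

Lemma EL_free_ring2_not_linear (K : fieldType) :
  ~ faithful_group_rep (EL free_ring2 3) K.
Proof.
case/faithful_group_rep_posdim=> n [rho [rhoG rhoM rhoI]].
have neq01 : (0 : 'I_3) != 1 by [].
have neq12 : (1 : 'I_3) != 2%:R by [].
have neq02 : (0 : 'I_3) != 2%:R by [].
have N_gt0 := fact_gt0 n.+1; set N := (n.+1)`! in N_gt0.
have [K0|] := pselect ([pchar K] =i pred0).
  have [m [phi phiP]] :=
    EL_rep_ring_rep rhoM rhoG rhoI K0 neq01 neq12 neq02 (erefl : (2 < 3)%N).
  apply: (@free_ring2_not_linear _ _ phi) => x y eq_xy.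
  apply/eqP; rewrite -subr_eq0; apply/eqP/(free_ring2_torsion_free N_gt0)/phiP.
  by rewrite rmorphB eq_xy subrr.
move=> pcharK; have [p pK] : exists p, p \in [pchar K].
  apply: contrapT => no_p; apply: pcharK => p.
  by apply/negP => pK; apply: no_p; exists p.
(* In characteristic [p] a power of this unipotent is 1, so faithfulness would make the positive
   integer [N p^(n+1)] vanish in the free ring. *)
have := root_mx_unipotentMn rhoM rhoG 1 (erefl : (2 < 3)%N) neq02.
move/(pchar_unipotent_exp pK); rewrite -(root_mxMn rhoM rhoG) //.
move/(root_mx_eq1 rhoM rhoG rhoI neq02); rewrite -mulrnA => M0.
have M_gt0 : (0 < N * p ^ n.+1)%N.
  by rewrite muln_gt0 N_gt0 expn_gt0 prime_gt0 // (pcharf_prime pK).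
by have /eqP := free_ring2_torsion_free M_gt0 M0; rewrite oner_eq0.
Qed.

Theorem theorem1 :
  (forall (RR : realType) (R : pzRingType) (k : nat), (3 <= k)%N ->
     faithful_group_rep (EL R k) (RR[i] : fieldType) <->
     exists I : set R,
       [/\ two_sided_ideal I, finite_index I
         & faithful_ideal_rep I (RR[i] : fieldType)])
  /\
  (forall K : fieldType, ~ faithful_group_rep (EL free_ring2 3) K).
Proof.
split=> [RR R k k_ge3|]; last exact: EL_free_ring2_not_linear.
exact: EL_faithful_iff.
Qed.
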